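(* For all $\epsilon>0$, there exists a finite-state Markov chain, with transition probabilities $P$, segregating two states $x$ and $y$ such that $$\lim_{n\to\infty}\lVert P^n(x,\cdot)-P^n(y,\cdot)\rVert_{\mathrm{TV}}>\frac{1}{\mathrm{e}}-\epsilon.$$
   Context: Markov chains are time-homogeneous and in discrete time. $P^n(x,\cdot)$ denotes the distribution of $X_n$ given $X_0=x$. For probability distributions $\mu,\nu$ on a countable set $S$, $\lVert\mu-\nu\rVert_{\mathrm{TV}}:=\sup_{A\subseteq S}|\mu(A)-\nu(A)|$. A coupling of two copies of the chain started in $x$ and $y$ is a process $((X_n,Y_n))_{n\in\mathbb{N}_0}$ on $S\times S$ such that $(X_n)$ and $(Y_n)$ are each Markov chains on $S$ (with respect to their own natural filtrations) with transition probabilities $P$ and $X_0=x$, $Y_0=y$. It is called Markovian if the process $((X_n,Y_n))_{n\in\mathbb{N}_0}$ is itself a (not necessarily time-homogeneous) Markov chain. A finite-state Markov chain is said to segregate the states $x$ and $y$ if $\lim_{n\to\infty}\lVert P^n(x,\cdot)-P^n(y,\cdot)\rVert_{\mathrm{TV}}>0$ while there exists a Markovian coupling of two copies of the chain, started in $x$ and $y$ respectively, whose first meeting time $\tau=\inf\{n\ge0: X_n=Y_n\}$ is finite with probability $1$. *)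

(* Defs.v *)
From mathcomp Require Import all_boot all_order all_algebra.
From mathcomp Require Import all_classical all_reals all_analysis.
Import Order.TTheory GRing.Theory Num.Theory.
Import numFieldNormedType.Exports.

Set Implicit Arguments.
Unset Strict Implicit.
Unset Printing Implicit Defensive.

Local Open Scope classical_set_scope.
Local Open Scope ring_scope.

Section TransitionProbabilities.
Context {R : realType} {S : finType}.
Implicit Types P : S -> S -> R.

Definition transition_probabilities P : Prop :=
  (forall x z, 0 <= P x z) /\ (forall x, \sum_z P x z = 1).

(* [nstep P n x] is P^n(x, .); see [law_markov_chain] below. *)
Fixpoint nstep P (n : nat) (x z : S) : R :=
  if n is m.+1 then \sum_u nstep P m x u * P u z else (x == z)%:R.

(* Distributions on S are given by their mass functions. *)
Definition tv_dist (mu nu : S -> R) : R :=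
  sup [set `|\sum_(z in A) mu z - \sum_(z in A) nu z| | A in [set: {set S}]].

End TransitionProbabilities.

Section Processes.
Context {R : realType} {d : measure_display} {T : measurableType d}.
Variable Pr : probability T R.

Definition cond_prob (A B : set T) : R := fine (Pr (A `&` B)) / fine (Pr B).

Section FiniteState.
Context {S : finType}.
Implicit Types Z : nat -> T -> S.

(* As S is finite, this is measurability of every Z n for the discrete
   sigma-algebra on S. *)
Definition process Z : Prop :=
  forall n z, measurable [set w | Z n w = z].

(* The event {Z_0 = s_0, ..., Z_n = s_n}; such events are the atoms of the
   natural filtration at time n. *)
Definition history Z (n : nat) (s : nat -> S) : set T :=
  [set w | forall k, (k <= n)%N -> Z k w = s k].

(* A Markov chain, not necessarily time-homogeneous. *)
Definition markov_process Z : Prop :=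
  process Z /\
  forall n (s : nat -> S) z, (0 < Pr (history Z n s))%E ->
    cond_prob [set w | Z n.+1 w = z] (history Z n s) =
    cond_prob [set w | Z n.+1 w = z] [set w | Z n w = s n].

(* A time-homogeneous Markov chain with transition probabilities P. *)
Definition markov_chain (P : S -> S -> R) Z : Prop :=
  process Z /\
  forall n (s : nat -> S) z, (0 < Pr (history Z n s))%E ->
    cond_prob [set w | Z n.+1 w = z] (history Z n s) = P (s n) z.

(* The first meeting time, which is +oo on paths that never meet. *)
Definition meeting_time (X Y : nat -> T -> S) (w : T) : \bar R :=
  ereal_inf [set (n%:R)%:E | n in [set n : nat | X n w = Y n w]].

Definition coupling (P : S -> S -> R) (x y : S) (X Y : nat -> T -> S) : Prop :=
  [/\ markov_chain P X, markov_chain P Y,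
      forall w, X 0%N w = x & forall w, Y 0%N w = y].

End FiniteState.

Definition markovian_coupling {S : finType} (P : S -> S -> R) (x y : S)
    (X Y : nat -> T -> S) : Prop :=
  coupling P x y X Y /\ markov_process (fun n w => (X n w, Y n w)).

End Processes.

Definition segregates {R : realType} {S : finType} (P : S -> S -> R)
    (x y : S) : Prop :=
  (exists2 l : R, (fun n => tv_dist (nstep P n x) (nstep P n y)) @ \oo --> l &
     0 < l) /\
  (exists (d : measure_display) (T : measurableType d) (Pr : probability T R)
      (X Y : nat -> T -> S),
    markovian_coupling Pr P x y X Y /\
    Pr [set w | (meeting_time X Y w < +oo :> \bar R)%E] = 1%E).

Section LawOfMarkovChain.
Context {R : realType} {d : measure_display} {T : measurableType d}.
Variable Pr : probability T R.
Context {S : finType}.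

Let pr (A : set T) : R := fine (Pr A).

Lemma pr_total (V : T -> S) (A : set T) :
    (forall z, measurable [set w | V w = z]) -> measurable A ->
  pr A = \sum_z pr (A `&` [set w | V w = z]).
Proof.
move=> mV mA.
have AE : A = \bigcup_(z in [set` index_enum S]) (A `&` [set w | V w = z]).
  apply/seteqP; split => [w Aw|w [z _ []]//].
  by exists (V w) => //=; rewrite mem_index_enum.
rewrite {1}AE /pr measure_fin_bigcup //.
- rewrite -fsbig_seq ?index_enum_uniq // -sum_fine // => z _.
  exact: fin_num_measure (measurableI _ _ mA (mV z)).
- by move=> z u _ _ [w [[_ <-] [_ <-]]].
- by move=> z _; apply: measurableI.
Qed.

Variables (P : S -> S -> R) (X : nat -> T -> S) (x : S).
Hypothesis mcX : markov_chain Pr P X.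
Hypothesis X0 : forall w, X 0%N w = x.

Let mX n z : measurable [set w | X n w = z]. Proof. by case: mcX. Qed.

Let m_history n s : measurable (history X n s).
Proof.
rewrite (_ : history X n s = \bigcap_(k in [set k | (k <= n)%N])
  [set w | X k w = s k]); first by apply: bigcap_measurable => //; exists 0%N.
by apply/seteqP; split => w /= h k; apply: h.
Qed.

Let history_step n s z :
  pr (history X n s `&` [set w | X n.+1 w = z]) = pr (history X n s) * P (s n) z.
Proof.
have [Pr0|Pr_neq0] := eqVneq (Pr (history X n s)) 0%E.
  rewrite /pr Pr0 mul0r (_ : Pr _ = 0%E) //.
  apply/eqP; rewrite eq_le measure_ge0 andbT -Pr0.
  by apply: le_measure; rewrite ?inE //; apply: measurableI.
have Pr_gt0 : (0 < Pr (history X n s))%E by rewrite lt0e Pr_neq0 measure_ge0.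
rewrite -((mcX.2) n s z Pr_gt0) /cond_prob setIC mulrC divfK //.
by rewrite fine_eq0 // fin_num_measure.
Qed.

Let step_history m n s z : (m <= n)%N ->
  pr (history X m s `&` [set w | X n w = s n] `&` [set w | X n.+1 w = z]) =
  pr (history X m s `&` [set w | X n w = s n]) * P (s n) z.
Proof.
elim: {m}(n - m)%N {-2}m (erefl (n - m)%N) s => [|k IH] m nm s lemn.
  have -> : m = n by apply/eqP; rewrite eqn_leq lemn -subn_eq0 nm.
  have -> : history X n s `&` [set w | X n w = s n] = history X n s.
    by apply/setIidl => w /(_ n (leqnn n)).
  exact: history_step.
have ltmn : (m < n)%N by rewrite -subn_gt0 nm.
pose B := history X m s `&` [set w | X n w = s n].
have mB : measurable B by apply: measurableI.
rewrite -/B (pr_total (mX m.+1)); last by apply: measurableI.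
rewrite [pr B](pr_total (mX m.+1)) // mulr_suml; apply: eq_bigr => t _.
have [nm1|nm1] := eqVneq n m.+1.
  have [->|nt] := eqVneq t (s n).
    have hB : B `&` [set w | X m.+1 w = s n] = history X m.+1 s `&` [set w | X n w = s n].
      apply/seteqP; split => [w [[h1 h2] h3]|w [h h2]]; split => //=.
      - by move=> j; rewrite leq_eqVlt => /predU1P[->|/h1//]; rewrite h3 nm1.
      - by split => // j jm; apply: h; apply: leqW.
      - by rewrite -nm1.
    rewrite setIAC hB IH //; first by rewrite nm1 subnn; move: nm; rewrite nm1 subSnn => -[].
  have hB : B `&` [set w | X m.+1 w = t] = set0.
    rewrite -subset0 => w [[_ /= h1] /= h2]; case/eqP: nt.
    by rewrite -h2 -h1 nm1.
  by rewrite setIAC hB set0I /pr measure0 /= mul0r.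
pose s' j := if j == m.+1 then t else s j.
have s'n : s' n = s n by rewrite /s' (negbTE nm1).
have hB : B `&` [set w | X m.+1 w = t] = history X m.+1 s' `&` [set w | X n w = s' n].
  rewrite s'n; apply/seteqP; split => [w [[h1 h2] h3]|w [h h2]]; split => //=.
  - move=> j; rewrite leq_eqVlt /s' => /predU1P[->|jm]; first by rewrite eqxx.
    by rewrite ltn_eqF // h1.
  - split => // j jm; rewrite (h j (leqW jm)) /s' ltn_eqF //.
  - by rewrite (h m.+1) // /s' eqxx.
by rewrite setIAC hB -s'n IH // subnS nm.
Qed.

Lemma law_markov_chain n z : Pr [set w | X n w = z] = (nstep P n x z)%:E.
Proof.
suff E : pr [set w | X n w = z] = nstep P n x z.
  by rewrite -E fineK // fin_num_measure.
elim: n z => [|n IH] z.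
  rewrite /pr /=; have [<-|xz] := eqVneq x z.
    rewrite (_ : [set w | _] = setT) ?probability_setT //.
    by apply/seteqP; split => w //= _; rewrite X0.
  rewrite (_ : [set w | _] = set0) ?measure0 //.
  by rewrite -subset0 => w /=; rewrite X0 => /eqP; rewrite (negbTE xz).
rewrite /= (pr_total (mX n)) //; apply: eq_bigr => u _; rewrite -IH setIC.
case: n IH => [|n] IH.
  have h : history X 0 (fun=> u) = [set w | X 0%N w = u].
    apply/seteqP; split => w /=; first by apply.
    by move=> Xw k; rewrite leqn0 => /eqP ->.
  by have := history_step 0 (fun=> u) z; rewrite h.
pose s k := if k is 0%N then x else u.
have h : history X 0 s = setT.
  by apply/seteqP; split => w //= _ k; rewrite leqn0 => /eqP ->; rewrite X0.
by have := @step_history 0 n.+1 s z isT; rewrite h !setTI.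
Qed.

End LawOfMarkovChain.

(* Main.v *)
(** A chain segregating two states with limit 3/8 >= 1/e, which suffices for
    every eps.  It has absorbing states [top] and [bot], and a line
    m0 -> m1 -> m2 -> bot that is left for [top] with probabilities
    1/5, 1/4, 1/3.  From [sy] the chain enters the line at a random time (after
    waiting in w1, w2) or falls to [bot]; from [sx] it goes to m0 or, through
    a1, a2, a3, to [top].

    In the coupling, Y meets X on the line when it enters it on its way to
    [bot]; at that moment X leaves for [top], so the two copies separate for
    good.  Copies of Y entering the line on their way to [top] do so while X is
    in a1, a2, a3, and the two meet at [top]; if Y never enters the line, X runs
    down it and both meet at [bot].  The weights make the fate of Y independent
    of its past given its current state, and likewise make X, observed alone,
    leave the line at the right rates.  X ends in [top] with probability 12/16
    and Y with probability 6/16. *)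

Require Import Defs.
From HB Require Import structures.
From mathcomp Require Import all_boot all_order all_algebra.
From mathcomp Require Import all_classical all_reals all_analysis.
From mathcomp Require Import zify lra.
Import Order.TTheory GRing.Theory Num.Theory.
Import numFieldNormedType.Exports.
Local Open Scope classical_set_scope.
Local Open Scope ring_scope.

(** * Preliminary estimates: ratios, total variation, and e *)

Lemma eq_natr_ratio (R : numFieldType) (a b c d : nat) :
    (0 < b)%N -> (0 < d)%N ->
  (a * d == c * b)%N -> a%:R / b%:R = c%:R / d%:R :> R.
Proof.
move=> b0 d0 /eqP h; apply/eqP.
by rewrite eqr_div ?pnatr_eq0 -?lt0n // -!natrM h.
Qed.

Lemma tv_dist_ge (R : realType) (S : finType) (mu nu : S -> R) (A : {set S}) :
  `|\sum_(z in A) mu z - \sum_(z in A) nu z| <= tv_dist mu nu.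
Proof.
apply: ub_le_sup; last by exists A.
(* The supremum must be of a bounded set; the sum over all subsets dominates each term. *)
exists (\sum_(B : {set S}) `|\sum_(z in B) mu z - \sum_(z in B) nu z|) => _ [B _ <-].
by rewrite (bigD1 B) //= lerDl sumr_ge0.
Qed.

(** The first four terms of the exponential series give 1 + 1 + 1/2 + 1/6 = 8/3, whose inverse is
    the limit 3/8 reached by the chain. *)
Lemma expR1_ge (R : realType) : 8 / 3 <= expR 1 :> R.
Proof.
have : series (exp_coeff 1) 4 <= expR 1 :> R.
  apply: nondecreasing_cvgn_le; last exact: is_cvg_series_exp_coeff.
  by apply: nondecreasing_series => k _ _; apply: exp_coeff_ge0.
have coeffE k : exp_coeff 1 k = k`!%:R^-1 :> R.
  by rewrite /exp_coeff /= expr1n mul1r.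
rewrite /series /= !big_nat_recr // big_geq // !coeffE.
rewrite -[0`!]/1%N -[1`!]/1%N -[2`!]/2%N -[3`!]/6%N /=; lra.
Qed.

(** * Probabilities as counts of equiprobable outcomes *)

Section UniformOutcome.
Context (R : realType) (n : nat).
Implicit Types a b : pred nat.

(* The uniform probability on {0, ..., n}, carried by [nat] because its discrete
   sigma-algebra is canonical. *)
Definition uniform_outcome : set nat -> \bar R :=
  mscale (n.+1%:R^-1)%:nng (msum (fun k => dirac k) n.+1).

HB.instance Definition _ := Measure.on uniform_outcome.

Lemma uniform_outcomeE b :
  uniform_outcome [set w | b w] = ((count b (iota 0 n.+1))%:R / n.+1%:R)%:E.
Proof.
have -> : iota 0 n.+1 = index_iota 0 n.+1 by rewrite /index_iota subn0.
rewrite -sum1_count big_mkord natr_sum mulrC EFinM -sumEFin.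
rewrite /uniform_outcome /mscale /msum big_mkcond /=; congr (_ * _)%E.
by apply: eq_bigr => k _; rewrite /= diracE mem_setE /in_mem /=; case: (b k).
Qed.

Lemma uniform_outcomeT : uniform_outcome setT = 1%E.
Proof.
rewrite (_ : setT = [set w | xpredT w]); last by apply/seteqP; split.
by rewrite uniform_outcomeE count_predT size_iota divff.
Qed.

HB.instance Definition _ :=
  Measure_isProbability.Build _ _ _ uniform_outcome uniform_outcomeT.

Lemma cond_uniform_outcome a b :
  cond_prob uniform_outcome [set w | a w] [set w | b w] =
  (count (predI a b) (iota 0 n.+1))%:R / (count b (iota 0 n.+1))%:R.
Proof.
rewrite /cond_prob (_ : _ `&` _ = [set w | predI a b w]); last first.
  by apply/seteqP; split => w /= => [[-> ->]|/andP[]].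
by rewrite /= !uniform_outcomeE /= invf_div mulrA divfK.
Qed.

End UniformOutcome.

(** * Deciding Markov properties by counting *)

Section EventuallyConstantProcess.
Context {R : realType} (n N : nat) {S : finType} (Z : nat -> nat -> S).
Hypothesis Zcst : forall k w, Z k w = Z (minn k N) w.

(** Boolean form of a [history] event, taken along the trajectory of [v], so that its outcomes can
    be counted by evaluation. *)
Let agree m v : pred nat :=
  fun w => all (fun k => Z k w == Z k v) (iota 0 m.+1).

Let agree_min m v : agree m v =1 agree (minn m N) v.
Proof.
move=> w; apply/allP/allP => h k; rewrite mem_iota /= add0n ltnS => km.
  by apply: h; rewrite mem_iota /= add0n ltnS (leq_trans km) // geq_minl.
rewrite Zcst [Z k v]Zcst; apply: h.
by rewrite mem_iota /= add0n ltnS leq_min geq_minr geq_min km.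
Qed.

Let Zcst_next m : Z m.+1 =1 Z (minn m N).+1.
Proof.
move=> w; rewrite Zcst [RHS]Zcst; congr (Z _ w); lia.
Qed.

(* A history of positive probability is that of some outcome [v], and only times
   up to [N] matter: this leaves finitely many conditions, decided by
   computation. *)
Lemma cond_prob_history m s z :
    (0 < uniform_outcome R n (history Z m s))%E ->
  exists k v, [/\ (k <= N)%N, (v <= n)%N, s m = Z k v,
    cond_prob (uniform_outcome R n) [set w | Z m.+1 w = z] (history Z m s) =
      (count (fun w => (Z k.+1 w == z) && agree k v w) (iota 0 n.+1))%:R /
      (count (agree k v) (iota 0 n.+1))%:R &
    cond_prob (uniform_outcome R n) [set w | Z m.+1 w = z]
        [set w | Z m w = s m] =
      (count (fun w => (Z k.+1 w == z) && (Z k w == Z k v)) (iota 0 n.+1))%:R /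
      (count (fun w => Z k w == Z k v) (iota 0 n.+1))%:R].
Proof.
rewrite (_ : history Z m s = [set w | `[< history Z m s w >]]); last first.
  by apply/seteqP; split => w /asboolP.
rewrite uniform_outcomeE lte_fin => h.
have /hasP[v] : has (fun w => `[< history Z m s w >]) (iota 0 n.+1).
  by rewrite has_count lt0n; apply: contraTneq h => ->; rewrite mul0r ltxx.
rewrite mem_iota add0n ltnS => /= vn /asboolP hv.
have sE k : (k <= m)%N -> s k = Z k v by move=> km; rewrite hv.
have hE w : `[< history Z m s w >] = agree (minn m N) v w.
  rewrite -agree_min; apply/asboolP/idP => [hw|].
    by apply/allP => k; rewrite mem_iota add0n ltnS => /= km; rewrite hw // sE.
  by move=> /allP hw k km; rewrite sE //; apply/eqP/hw; rewrite mem_iota.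
exists (minn m N), v; split; rewrite ?geq_minr ?sE //.
- rewrite -cond_uniform_outcome; congr cond_prob.
  + by apply/seteqP; split => w; rewrite /= (Zcst_next m) => /eqP.
  + by apply/seteqP; split => w; rewrite /= hE.
- rewrite -cond_uniform_outcome; congr cond_prob.
  + by apply/seteqP; split => w; rewrite /= (Zcst_next m) => /eqP.
  + by apply/seteqP; split => w; rewrite /= !(Zcst m) => /eqP.
Qed.

(** Denominators are cleared so that the test runs in [nat]. It is enough to let [z] range over the
    values taken at time [k.+1]: for any other value both numerators vanish. *)
Definition markov_process_check :=
  all (fun k => all (fun v => all (fun z =>
    count (fun w => (Z k.+1 w == z) && agree k v w) (iota 0 n.+1) *
      count (fun w => Z k w == Z k v) (iota 0 n.+1) ==
    count (fun w => (Z k.+1 w == z) && (Z k w == Z k v)) (iota 0 n.+1) *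
      count (agree k v) (iota 0 n.+1))%N
  (map (Z k.+1) (iota 0 n.+1))) (iota 0 n.+1)) (iota 0 N.+1).

Definition markov_chain_check (states : seq S) (moves : S -> seq S) :=
  all (fun k => all (fun v => all (fun z =>
    count (fun w => (Z k.+1 w == z) && agree k v w) (iota 0 n.+1) *
      size (moves (Z k v)) ==
    count_mem z (moves (Z k v)) * count (agree k v) (iota 0 n.+1))%N
  states) (iota 0 n.+1)) (iota 0 N.+1).

Let count_gt0 (b : pred nat) v : (v <= n)%N -> b v ->
  (0 < count b (iota 0 n.+1))%N.
Proof.
by move=> vn bv; rewrite -has_count; apply/hasP; exists v => //; rewrite mem_iota.
Qed.

Let agree_refl k v : agree k v v. Proof. by apply/allP => j _ /=. Qed.

Lemma markov_processP : markov_process_check ->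
  markov_process (uniform_outcome R n) Z.
Proof.
move=> /allP h; split=> // m s z /(cond_prob_history m s z)[k [v [kN vn _ -> ->]]].
apply: eq_natr_ratio; do ?exact: count_gt0 vn _.
have [zZ|zZ] := boolP (z \in map (Z k.+1) (iota 0 n.+1)).
  move: (h k); rewrite mem_iota => /(_ kN)/allP/(_ v).
  by rewrite mem_iota => /(_ vn)/allP/(_ z zZ).
have unreached (b : pred nat) :
    count (fun w => (Z k.+1 w == z) && b w) (iota 0 n.+1) = 0%N.
  apply/eqP; rewrite eqn0Ngt -has_count; apply: contra zZ => /hasP[w wn].
  by move=> /andP[/eqP <- _]; apply: map_f.
by rewrite !unreached !mul0n.
Qed.

Lemma markov_chainP (states : seq S) (moves : S -> seq S) :
    (forall z, z \in states) -> (forall u, 0 < size (moves u))%N ->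
    markov_chain_check states moves ->
  markov_chain (uniform_outcome R n)
    (fun u z => (count_mem z (moves u))%:R / (size (moves u))%:R) Z.
Proof.
move=> mem_states moves0 /allP h; split=> // m s z.
move=> /(cond_prob_history m s z)[k [v [kN vn -> -> _]]].
apply: eq_natr_ratio => //; first exact: count_gt0 vn _.
move: (h k); rewrite mem_iota => /(_ kN)/allP/(_ v).
by rewrite mem_iota => /(_ vn)/allP/(_ z (mem_states z)).
Qed.

End EventuallyConstantProcess.

(** * The chain and its coupled trajectories *)

Inductive state := sx | sy | a1 | a2 | a3 | m0 | m1 | m2 | w1 | w2 | top | bot.

Definition states := [:: sx; sy; a1; a2; a3; m0; m1; m2; w1; w2; top; bot].

Definition code (s : state) : nat :=
  match s with
  | sx => 0 | sy => 1 | a1 => 2 | a2 => 3 | a3 => 4 | m0 => 5 | m1 => 6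
  | m2 => 7 | w1 => 8 | w2 => 9 | top => 10 | bot => 11
  end.

Definition decode (i : nat) : option state := onth states i.

Lemma codeK : pcancel code decode. Proof. by case. Qed.

HB.instance Definition _ := Countable.copy state (pcan_type codeK).

Lemma states_enum : Finite.axiom states. Proof. by case. Qed.

HB.instance Definition _ := fintype.isFinite.Build state states_enum.

(* The next state is drawn uniformly from the list. *)
Definition moves (s : state) : seq state :=
  match s with
  | sx => nseq 10 m0 ++ nseq 6 a1
  | sy => nseq 5 m0 ++ nseq 11 w1
  | a1 => [:: a2]
  | a2 => [:: a3]
  | a3 => [:: top]
  | m0 => top :: nseq 4 m1
  | m1 => top :: nseq 3 m2
  | m2 => top :: nseq 2 bot
  | w1 => nseq 4 m1 ++ nseq 7 w2
  | w2 => nseq 3 m2 ++ nseq 4 bot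
  | top => [:: top]
  | bot => [:: bot]
  end.

(* Sixteen equiprobable trajectories of (X, Y), constant from time 4 on. *)
Definition paths : seq (seq state * seq state) :=
  nseq 2 ([:: sx; m0; top; top; top], [:: sy; m0; m1; m2; bot]) ++
  nseq 2 ([:: sx; m0; m1; top; top], [:: sy; w1; m1; m2; bot]) ++
  nseq 2 ([:: sx; m0; m1; m2; top], [:: sy; w1; w2; m2; bot]) ++
  nseq 4 ([:: sx; m0; m1; m2; bot], [:: sy; w1; w2; bot; bot]) ++
  [:: ([:: sx; a1; a2; a3; top], [:: sy; m0; top; top; top]);
      ([:: sx; a1; a2; a3; top], [:: sy; m0; m1; top; top]);
      ([:: sx; a1; a2; a3; top], [:: sy; m0; m1; m2; top]);
      ([:: sx; a1; a2; a3; top], [:: sy; w1; m1; top; top]);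
      ([:: sx; a1; a2; a3; top], [:: sy; w1; m1; m2; top]);
      ([:: sx; a1; a2; a3; top], [:: sy; w1; w2; m2; top])].

(* The null outcomes [w >= 16] are sent to the first path, so that every path
   starts at (sx, sy). *)
Definition path_of (w : nat) := nth (head ([::], [::]) paths) paths w.
Definition X (k w : nat) : state := nth sx (path_of w).1 (minn k 4).
Definition Y (k w : nat) : state := nth sy (path_of w).2 (minn k 4).

Lemma X_check : markov_chain_check 15 4 X states moves.
Proof. by vm_compute. Qed.
Lemma Y_check : markov_chain_check 15 4 Y states moves.
Proof. by vm_compute. Qed.
Lemma XY_check : markov_process_check 15 4 (fun k w => (X k w, Y k w)).
Proof. by vm_compute. Qed.

Definition transition (R : realType) (u z : state) : R :=
  (count_mem z (moves u))%:R / (size (moves u))%:R.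

Lemma moves_gt0 u : (0 < size (moves u))%N. Proof. by case: u. Qed.

Lemma transition_is_probability (R : realType) :
  transition_probabilities (transition R).
Proof.
split=> [u z|u]; first by rewrite divr_ge0.
rewrite -mulr_suml -natr_sum.
rewrite (_ : (\sum_z _)%N = size (moves u)) ?divff ?pnatr_eq0 -?lt0n ?moves_gt0//.
rewrite -count_predT -sum1_count.
rewrite [RHS](partition_big id xpredT) //; apply: eq_bigr => z _.
by rewrite -sum1_count.
Qed.

(** * The coupling and the limiting distance *)

Section Coupling.
Variable R : realType.
Let Pr := uniform_outcome R 15.

Lemma X_cst k w : X k w = X (minn k 4) w.
Proof. by rewrite /X -minnA minnn. Qed.

Lemma Y_cst k w : Y k w = Y (minn k 4) w.
Proof. by rewrite /Y -minnA minnn. Qed.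

Lemma mem_states z : z \in states. Proof. by case: z. Qed.

Lemma X_markov_chain : markov_chain Pr (transition R) X.
Proof.
exact: (markov_chainP _ _ _ X_cst _ _ mem_states moves_gt0 X_check).
Qed.

Lemma Y_markov_chain : markov_chain Pr (transition R) Y.
Proof.
exact: (markov_chainP _ _ _ Y_cst _ _ mem_states moves_gt0 Y_check).
Qed.

(** The default of [nth] is itself in [paths], so sixteen checks settle all outcomes in [nat], null
    ones included. *)
Lemma path_of_ind (Q : _ -> Prop) :
  {in paths, forall p, Q p} -> forall w, Q (path_of w).
Proof.
move=> h w; rewrite /path_of; case: (ltnP w (size paths)) => wp.
  exact/h/mem_nth.
by rewrite nth_default //; apply: h.
Qed.

Lemma X0 w : X 0 w = sx.
Proof.
have /allP : all (fun p => nth sx p.1 0 == sx) paths by [].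
by rewrite /X min0n => h; exact/eqP/(path_of_ind _ h).
Qed.

Lemma Y0 w : Y 0 w = sy.
Proof.
have /allP : all (fun p => nth sy p.2 0 == sy) paths by [].
by rewrite /Y min0n => h; exact/eqP/(path_of_ind _ h).
Qed.

Lemma XY_meet w : exists k, X k w = Y k w.
Proof.
have /hasP[k] : has (fun k => X k w == Y k w) (iota 0 5).
  apply: (path_of_ind (fun p => has (fun k =>
    nth sx p.1 (minn k 4) == nth sy p.2 (minn k 4)) (iota 0 5))).
  by apply/allP.
by move=> _ /eqP; exists k.
Qed.

Lemma XY_markovian_coupling : markovian_coupling Pr (transition R) sx sy X Y.
Proof.
split; first by split; [exact: X_markov_chain|exact: Y_markov_chain|
  exact: X0|exact: Y0].
apply: markov_processP XY_check => k w.
by rewrite X_cst Y_cst.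
Qed.

(** The coupling itself yields the n-step law: X is a chain from [sx], so the law is found by
    counting trajectories instead of multiplying matrices. *)
Lemma nstep_sx k z : nstep (transition R) k sx z =
  (count (fun w => X k w == z) (iota 0 16))%:R / 16%:R.
Proof.
have := law_markov_chain X_markov_chain X0 k z.
rewrite (_ : [set w | X k w = z] = [set w | X k w == z]).
  by rewrite [LHS]uniform_outcomeE => -[].
by apply/seteqP; split => w /eqP.
Qed.

Lemma nstep_sy k z : nstep (transition R) k sy z =
  (count (fun w => Y k w == z) (iota 0 16))%:R / 16%:R.
Proof.
have := law_markov_chain Y_markov_chain Y0 k z.
rewrite (_ : [set w | Y k w = z] = [set w | Y k w == z]).
  by rewrite [LHS]uniform_outcomeE => -[].
by apply/seteqP; split => w /eqP.
Qed.

(** By time 4 every trajectory is absorbed in [top] or [bot], so the sequence of distances is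
    constant from there on. *)
Lemma tv_dist_cvg :
  (fun k => tv_dist (nstep (transition R) k sx) (nstep (transition R) k sy))
    @ \oo --> tv_dist (nstep (transition R) 4 sx) (nstep (transition R) 4 sy).
Proof.
apply: cvg_near_cst; exists 4%N => // k k4.
congr tv_dist; apply/funext => z; rewrite ?nstep_sx ?nstep_sy;
  congr (_%:R / _); apply: eq_count => w.
  by rewrite X_cst (minn_idPr k4).
by rewrite Y_cst (minn_idPr k4).
Qed.

Lemma tv_dist_lim_ge :
  3 / 8 <= tv_dist (nstep (transition R) 4 sx) (nstep (transition R) 4 sy).
Proof.
(* The event of sitting in [top] separates the laws: 12/16 - 6/16 = 3/8. *)
apply: le_trans (tv_dist_ge _ _ _ _ [set top]%SET).
rewrite !big_set1 nstep_sx nstep_sy.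
rewrite (_ : count _ _ = 12%N); last by vm_compute.
rewrite (_ : count _ _ = 6%N); last by vm_compute.
by apply: le_trans (ler_norm _); lra.
Qed.

End Coupling.

Theorem proposition5p2 (R : realType) (eps : R) (heps : 0 < eps) :
  exists (S : finType) (P : S -> S -> R) (x y : S),
    [/\ transition_probabilities P,
        segregates P x y &
        exists2 l : R,
          (fun n => tv_dist (nstep P n x) (nstep P n y)) @ \oo --> l &
          (expR 1)^-1 - eps < l].
Proof.
have lim_ge := tv_dist_lim_ge R.
exists state, (transition R), sx, sy; split.
- exact: transition_is_probability.
- split; first by eexists; [exact: tv_dist_cvg|apply: lt_le_trans lim_ge; lra].
  exists _, nat, (uniform_outcome R 15), X, Y; split.
    exact: XY_markovian_coupling.
  (* The copies meet on every path, not just almost surely. *)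
  rewrite (_ : [set w | _] = setT) ?probability_setT //.
  apply/seteqP; split => w //= _; have [k XYk] := XY_meet w.
  apply: le_lt_trans (ltry k%:R); apply: ereal_inf_lbound.
  by exists k.
- eexists; first exact: tv_dist_cvg.
  apply: lt_le_trans lim_ge.
  (* A weak inequality is enough here, since [eps] is positive. *)
  have : (expR 1)^-1 <= 3 / 8 :> R.
    by rewrite -[leRHS]invrK invf_div lef_pV2 ?posrE ?expR_gt0 ?expR1_ge.
  by lra.
Qed.
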